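(* The Lie group $(F_{4,\mathbb{R}})^{\mathbb{C}}$ is isomorphic to the Lie group $SO(3,\mathbb{C})$: $(F_{4,\mathbb{R}})^{\mathbb{C}} \cong SO(3,\mathbb{C})$.
   Context: Let $(\mathfrak{J}_{\mathbb{R}})^{\mathbb{C}}$ be the 6-dimensional complex vector space of symmetric $3\times 3$ complex matrices, with the Jordan multiplication $X\circ Y=\frac12(XY+YX)$. Define $(F_{4,\mathbb{R}})^{\mathbb{C}}=\{\alpha\in \mathrm{Iso}_{\mathbb{C}}((\mathfrak{J}_{\mathbb{R}})^{\mathbb{C}}) \mid \alpha(X\circ Y)=\alpha X\circ\alpha Y \text{ for all } X,Y\}$, where $\mathrm{Iso}_{\mathbb{C}}(V)$ denotes the group of $\mathbb{C}$-linear automorphisms of the vector space $V$. $SO(3,\mathbb{C})=\{A\in M(3,\mathbb{C})\mid A\,{}^tA=E,\ \det A=1\}$, $E$ the unit matrix. *)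

(* Defs.v *)
From HB Require Import structures.
From mathcomp Require Import all_boot all_order all_algebra.
From mathcomp Require Import complex.
From mathcomp Require Import all_classical all_reals all_analysis.
Set Implicit Arguments.
Unset Strict Implicit.
Unset Printing Implicit Defensive.
Import Order.TTheory GRing.Theory Num.Theory.
Import numFieldNormedType.Exports.
Local Open Scope classical_set_scope.
Local Open Scope ring_scope.

Section SymmetricJordanAlgebra.
Variable K : numFieldType.

Let asym (X : 'M[K]_3) : 'M[K]_3 := X^T - X.

Fact asym_linear : linear asym.
Proof. by move=> a X Y; rewrite /asym linearP scalerBr opprD addrACA. Qed.
HB.instance Definition _ := GRing.isSemilinear.Build K _ _ _ asym
  (GRing.semilinear_linear asym_linear).

Definition symmx : {vspace 'M[K]_3} := lker (linfun asym).

Lemma symmxP (X : 'M[K]_3) : reflect (X^T = X) (X \in symmx).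
Proof. by rewrite memv_ker lfunE /= subr_eq0; apply: eqP. Qed.

Definition symJ := subvs_of symmx.

Fact jordan_subproof (X Y : symJ) :
  2^-1 *: (vsval X *m vsval Y + vsval Y *m vsval X) \in symmx.
Proof.
have [/symmxP sX /symmxP sY] := (valP X, valP Y).
by apply/symmxP; rewrite linearZ linearD /= !trmx_mul sX sY addrC.
Qed.

Definition jordan (X Y : symJ) : symJ := Subvs (jordan_subproof X Y).

Definition jordan_automorphism (a : 'End(symJ)) : Prop :=
  bijective a /\ forall X Y, a (jordan X Y) = jordan (a X) (a Y).

Record F4R := MkF4R {
  F4Rval :> 'End(symJ);
  F4RvalP : `[< jordan_automorphism F4Rval >] }.

HB.instance Definition _ := [isSub for F4Rval].
HB.instance Definition _ := [Choice of F4R by <:].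

Fact F4R_1 : `[< jordan_automorphism \1%VF >].
Proof.
by apply/asboolP; split=> [|X Y]; [exists id => X|]; rewrite !id_lfunE.
Qed.

Fact F4R_M (a b : F4R) : `[< jordan_automorphism (F4Rval a \o F4Rval b)%VF >].
Proof.
case: a b => a /asboolP[ba aP] [b /asboolP[bb bP]] /=.
apply/asboolP; split=> [|X Y]; last by rewrite !comp_lfunE bP aP.
by apply: (eq_bij (bij_comp ba bb)) => X; rewrite comp_lfunE.
Qed.

Lemma F4R_lker0 (a : F4R) : lker (F4Rval a) == 0%VS.
Proof. by apply/lker0P; have /asboolP[/bij_inj] := F4RvalP a. Qed.

Fact F4R_V (a : F4R) : `[< jordan_automorphism (F4Rval a)^-1%VF >].
Proof.
have [k0 /asboolP[_ aP]] := (F4R_lker0 a, F4RvalP a).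
apply/asboolP; split=> [|X Y].
  by exists (F4Rval a); [exact: lker0_lfunVK | exact: lker0_lfunK].
by apply: (lker0P k0); rewrite aP !lker0_lfunVK.
Qed.

Let F4Rone := MkF4R F4R_1.
Let F4Rmul a b := MkF4R (F4R_M a b).
Let F4Rinv a := MkF4R (F4R_V a).

Fact F4RmulA : associative F4Rmul.
Proof. by move=> a b c; apply: val_inj; rewrite /= comp_lfunA. Qed.
Fact F4Rmul1 : left_id F4Rone F4Rmul.
Proof. by move=> a; apply: val_inj; rewrite /= comp_lfun1l. Qed.
Fact F4Rmulr1 : right_id F4Rone F4Rmul.
Proof. by move=> a; apply: val_inj; rewrite /= comp_lfun1r. Qed.
Fact F4RmulV : left_inverse F4Rone F4Rinv F4Rmul.
Proof. by move=> a; apply: val_inj; rewrite /= lker0_compVf ?F4R_lker0. Qed.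
Fact F4RmulrV : right_inverse F4Rone F4Rinv F4Rmul.
Proof. by move=> a; apply: val_inj; rewrite /= lker0_compfV ?F4R_lker0. Qed.

HB.instance Definition _ := isGroup.Build F4R
  F4RmulA F4Rmul1 F4Rmulr1 F4RmulV F4RmulrV.

End SymmetricJordanAlgebra.

Section SpecialOrthogonal.
Variable K : numFieldType.

Definition special_orthogonal (A : 'M[K]_3) : bool :=
  (A *m A^T == 1%:M) && (\det A == 1).

Record SO3 := MkSO3 {
  SO3val :> 'M[K]_3;
  SO3valP : special_orthogonal SO3val }.

HB.instance Definition _ := [isSub for SO3val].
HB.instance Definition _ := [Choice of SO3 by <:].

Fact SO3_1 : special_orthogonal 1%:M.
Proof. by rewrite /special_orthogonal trmx1 mulmx1 det1 !eqxx. Qed.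

Fact SO3_M (A B : SO3) : special_orthogonal (SO3val A *m SO3val B).
Proof.
case: A B => A /andP[/eqP A1 /eqP dA] [B /andP[/eqP B1 /eqP dB]] /=.
rewrite /special_orthogonal det_mulmx dA dB mul1r eqxx andbT.
by rewrite trmx_mul mulmxA -(mulmxA A) B1 mulmx1 A1.
Qed.

Fact SO3_V (A : SO3) : special_orthogonal (SO3val A)^T.
Proof.
case: A => A /andP[/eqP A1 dA] /=.
by rewrite /special_orthogonal det_tr dA andbT trmxK (mulmx1C A1).
Qed.

Let SO3one := MkSO3 SO3_1.
Let SO3mul A B := MkSO3 (SO3_M A B).
Let SO3inv A := MkSO3 (SO3_V A).

Fact SO3mulA : associative SO3mul.
Proof. by move=> A B C; apply: val_inj; rewrite /= mulmxA. Qed.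
Fact SO3mul1 : left_id SO3one SO3mul.
Proof. by move=> A; apply: val_inj; rewrite /= mul1mx. Qed.
Fact SO3mulr1 : right_id SO3one SO3mul.
Proof. by move=> A; apply: val_inj; rewrite /= mulmx1. Qed.
Fact SO3mulrV : right_inverse SO3one SO3inv SO3mul.
Proof.
by move=> A; apply: val_inj => /=; have /andP[/eqP] := SO3valP A.
Qed.
Fact SO3mulV : left_inverse SO3one SO3inv SO3mul.
Proof.
move=> A; apply: val_inj => /=.
by have /andP[/eqP/mulmx1C] := SO3valP A.
Qed.

HB.instance Definition _ := isGroup.Build SO3
  SO3mulA SO3mul1 SO3mulr1 SO3mulV SO3mulrV.

End SpecialOrthogonal.

Section LieIsomorphism.
Variable K : numFieldType.

(* The topology of a finite-dimensional space is that of its coordinate row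
   vectors; it does not depend on the basis.  Since [differentiable] is
   K-linear Frechet differentiability, [holomorphic] is complex holomorphy
   when K = R[i]. *)
Definition coords (V : vectType K) : V -> 'rV[K]_(\dim {:V}) :=
  passmx.rVof (vbasis {:V}).
Definition of_coords (V : vectType K) : 'rV[K]_(\dim {:V}) -> V :=
  passmx.vecof (vbasis {:V}).

Definition holomorphic_at (V W : vectType K) (F : V -> W) (x : V) : Prop :=
  \forall y \near coords x,
    differentiable (@coords W \o F \o @of_coords V) y.

(* [iG] and [iH] are injections presenting G and H as subsets of V and W.  A map
   between embedded complex submanifolds is holomorphic iff it is locally the
   restriction of a holomorphic map between open subsets of the ambient spaces.
   [F4R] and [SO3] are subgroups of general linear groups cut out by polynomial
   equations, so their Lie group structure is that of embedded submanifolds. *)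
Definition holomorphic_map (V W : vectType K) (G H : Type)
    (iG : G -> V) (iH : H -> W) (f : G -> H) : Prop :=
  forall g : G, exists2 F : V -> W, holomorphic_at F (iG g) &
    \forall y \near coords (iG g),
      forall h : G, coords (iG h) = y -> F (iG h) = iH (f h).

Definition lie_isomorphic (V W : vectType K) (G H : groupType)
    (iG : G -> V) (iH : H -> W) : Prop :=
  exists (f : G -> H) (f' : H -> G),
    [/\ {morph f : x y / (x * y)%g}, cancel f f', cancel f' f,
        holomorphic_map iG iH f & holomorphic_map iH iG f'].

End LieIsomorphism.

(* Main.v *)
From HB Require Import structures.
Require Import Defs.
From mathcomp Require Import all_boot all_order all_algebra.
From mathcomp Require Import complex.
From mathcomp Require Import all_classical all_reals all_analysis.
From mathcomp Require Import ring.
Set Implicit Arguments.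
Unset Strict Implicit.
Unset Printing Implicit Defensive.
Import Order.TTheory GRing.Theory Num.Theory.
Import numFieldNormedType.Exports.
Local Open Scope ring_scope.
Local Open Scope complex_scope.

(** A rotation A acts on symmetric matrices by X |-> A X A^T.  Conversely, a
    Jordan automorphism a preserves double commutators [[X, Y], Z], since these
    are expressible through the Jordan product.  So [X, Y] |-> [a X, a Y] is a
    well-defined Lie automorphism of the skew-symmetric matrices, which are the
    Lie algebra K^3 with the cross product; its matrix A satisfies
    A (u x v) = A u x A v, i.e. A equals its own cofactor matrix, and this
    forces A A^T = 1 and det A = 1.  Then X |-> A^T (a X) A is a Jordan automorphism
    commuting with all brackets by skew-symmetric matrices, hence the identity.
    The entries of A are quadratic in a, and X |-> A X A^T is quadratic in A, so
    both directions are restrictions of globally defined polynomial maps. *)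

(** * Cyclic index arithmetic in Z/3 *)

Lemma ord3P (P : 'I_3 -> Prop) :
  P 0 -> P 1 -> P (1 + 1) -> forall i, P i.
Proof.
move=> P0 P1 P2 [[|[|[|//]]] lti].
- by rewrite (_ : Ordinal _ = 0) //; apply: val_inj.
- by rewrite (_ : Ordinal _ = 1) //; apply: val_inj.
- by rewrite (_ : Ordinal _ = 1 + 1) //; apply: val_inj.
Qed.

Lemma ord3_add3 (i : 'I_3) : i + 1 + 1 + 1 = i.
Proof. by elim/ord3P: i; apply: val_inj. Qed.

(** Counting from an arbitrary base keeps [k] symbolic in case analyses, so cyclic symmetry replaces
    enumeration. *)
Lemma ord3_cyclicP (k : 'I_3) (P : 'I_3 -> Prop) :
  P k -> P (k + 1) -> P (k + 1 + 1) -> forall i, P i.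
Proof.
move=> P0 P1 P2 i; rewrite -(subrK k i) addrC.
by elim/ord3P: (i - k); rewrite ?addrA ?addr0.
Qed.

Lemma ord3_neq (i : 'I_3) :
  (((i == i + 1)%R = false) * ((i == i + 1 + 1)%R = false) *
   ((i + 1 == i)%R = false) * ((i + 1 + 1 == i)%R = false) *
   ((i + 1 == i + 1 + 1)%R = false) * ((i + 1 + 1 == i + 1)%R = false))%type.
Proof. by elim/ord3P: i. Qed.

Definition ord3E := (ord3_add3, ord3_neq, eqxx, mulr1n, mulr0n).

Lemma sum_ord3 (V : nmodType) (k : 'I_3) (F : 'I_3 -> V) :
  \sum_i F i = F k + F (k + 1) + F (k + 1 + 1).
Proof.
rewrite (bigD1 k) //= (bigD1 (k + 1)) ?ord3E //= (bigD1 (k + 1 + 1)) ?ord3E //=.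
rewrite big1 ?addr0 ?addrA //.
by elim/(@ord3_cyclicP k); rewrite eqxx ?andbF.
Qed.

(** * Commutators, anticommutators and the generators of the rotation Lie algebra *)

Section RotationGenerators.
Variable K : comNzRingType.
Implicit Types (A B X Y Z : 'M[K]_3) (i j k p q : 'I_3).

Lemma mulmx_deltaE A i j p q : (A *m delta_mx i j) p q = A p i *+ (j == q).
Proof.
rewrite mxE (bigD1 i) //= big1 => [|l /negPf li]; rewrite mxE ?li ?mulr0 //.
by rewrite eqxx /= mulr_natr addr0 eq_sym.
Qed.

Lemma mul_delta_mxE A i j p q : (delta_mx i j *m A) p q = A j q *+ (p == i).
Proof.
rewrite mxE (bigD1 j) //= big1 => [|l /negPf li]; rewrite mxE ?li ?andbF ?mul0r //.
by rewrite eqxx andbT mulr_natl addr0.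
Qed.

Definition commx X Y := X *m Y - Y *m X.
Definition acommx X Y := X *m Y + Y *m X.

(* Indices are added in 'I_3 = Z/3, so that [rotgen k] is the matrix of the cross
   product with the k-th basis vector, for every k. *)
Definition rotgen k : 'M[K]_3 :=
  delta_mx (k + 1 + 1) (k + 1) - delta_mx (k + 1) (k + 1 + 1).
Definition symgen k : 'M[K]_3 :=
  delta_mx (k + 1) (k + 1 + 1) + delta_mx (k + 1 + 1) (k + 1).

Lemma commx_rotgen k : commx (rotgen (k + 1)) (rotgen (k + 1 + 1)) = rotgen k.
Proof.
rewrite /commx /rotgen !ord3E !(mulmxBl, mulmxBr) !mul_delta_mx_cond !ord3E.
by rewrite !(addr0, add0r, subr0, sub0r, opprK, oppr0).
Qed.

(** Presents each generator as a bracket of symmetric matrices, through which a Jordan automorphism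
    can transport it. *)
Lemma commx_delta_symgen k :
  commx (delta_mx (k + 1 + 1) (k + 1 + 1)) (symgen k) = rotgen k.
Proof.
rewrite /commx /rotgen /symgen !(mulmxDl, mulmxDr) !mul_delta_mx_cond !ord3E.
by rewrite !(addr0, add0r, subr0, sub0r, opprK, oppr0).
Qed.

(** Lets values on the off-diagonal [symgen k] be deduced from values on diagonal units. *)
Lemma commx_rotgen_delta k :
  commx (rotgen k) (delta_mx (k + 1 + 1) (k + 1 + 1)) = - symgen k.
Proof.
rewrite /commx /rotgen /symgen !(mulmxBl, mulmxBr) !mul_delta_mx_cond !ord3E.
by rewrite !(addr0, add0r, subr0, sub0r, opprK, oppr0) opprD.
Qed.

Lemma tr_rotgen k : (rotgen k)^T = - rotgen k.
Proof. by rewrite /rotgen linearB /= !trmx_delta opprB. Qed.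

Lemma tr_symgen k : (symgen k)^T = symgen k.
Proof. by rewrite /symgen linearD /= !trmx_delta addrC. Qed.

Lemma mulmx_rotgenE A B k p q : (A *m rotgen k *m B) p q =
  A p (k + 1 + 1) * B (k + 1) q - A p (k + 1) * B (k + 1 + 1) q.
Proof.
have deltaE i j : (A *m delta_mx i j *m B) p q = A p i * B j q.
  rewrite mxE (bigD1 j) //= big1 => [|l /negPf lj].
    by rewrite mulmx_deltaE eqxx addr0.
  by rewrite mulmx_deltaE eq_sym lj mul0r.
by rewrite /rotgen mulmxBr mulmxBl mxE [X in _ + X]mxE !deltaE.
Qed.

(** Cyclic order of rows and columns absorbs the sign $(-1)^{i+j}$. *)
Lemma cofactor3 A i j :
  cofactor A i j = A (i + 1) (j + 1) * A (i + 1 + 1) (j + 1 + 1)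
                 - A (i + 1) (j + 1 + 1) * A (i + 1 + 1) (j + 1).
Proof.
have det2 (B : 'M[K]_2) : \det B = B 0 0 * B 1 1 - B 0 1 * B 1 0.
  rewrite (expand_det_row _ 0) !big_ord_recl big_ord0 /cofactor !det_mx11 !mxE.
  have -> : lift 0 0 = 1 :> 'I_2 by apply: val_inj.
  have -> : lift 1 0 = 0 :> 'I_2 by apply: val_inj.
  by rewrite /= expr0 expr1 mul1r mulN1r mulrN addr0.
(* With entries indexed by natural numbers, indices reduce by computation and [ring] recognizes
   equal entries. *)
have [f AE] : exists f : nat -> nat -> K, forall p q, A p q = f p q.
  by exists (fun m n => A (inord m) (inord n)) => p q; rewrite !inord_val.
rewrite /cofactor det2 !mxE !AE.
by elim/ord3P: i; elim/ord3P: j => /=; ring.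
Qed.

(** On the right, the terms with [Z] in the middle cancel. *)
Lemma commx_commxE X Y Z :
  commx (commx X Y) Z = acommx X (acommx Y Z) - acommx Y (acommx X Z).
Proof.
rewrite /commx /acommx !(mulmxDl, mulmxDr, mulNmx, mulmxN) !mulmxA.
move: (X *m Y *m Z) (Y *m X *m Z) (Z *m X *m Y) (Z *m Y *m X) => a b c d.
move: (X *m Z *m Y) (Y *m Z *m X) => e f.
by apply/matrixP=> p q; rewrite !mxE; ring.
Qed.

Lemma commx_jacobi X Y Z :
  commx (commx X Y) Z = commx X (commx Y Z) - commx Y (commx X Z).
Proof.
rewrite /commx !(mulmxDl, mulmxDr, mulNmx, mulmxN, opprK) !mulmxA.
move: (X *m Y *m Z) (Y *m X *m Z) (Z *m X *m Y) (Z *m Y *m X) => a b c d.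
move: (X *m Z *m Y) (Y *m Z *m X) => e f.
by apply/matrixP=> p q; rewrite !mxE; ring.
Qed.

Lemma commxBl X Y Z : commx (X - Y) Z = commx X Z - commx Y Z.
Proof. by rewrite /commx mulmxBl mulmxBr !opprD opprK addrACA. Qed.

Lemma commxPl (b : K) X X' Y :
  commx (b *: X + X') Y = b *: commx X Y + commx X' Y.
Proof.
by rewrite /commx mulmxDl mulmxDr -scalemxAl -scalemxAr opprD addrACA scalerBr.
Qed.

Lemma commxPr (b : K) X Y Y' :
  commx X (b *: Y + Y') = b *: commx X Y + commx X Y'.
Proof.
by rewrite /commx mulmxDl mulmxDr -scalemxAl -scalemxAr opprD addrACA scalerBr.
Qed.

Lemma commx_add_scalar X Y (a b : K) :
  commx X (a *: 1%:M + b *: Y) = b *: commx X Y.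
Proof.
rewrite /commx mulmxDl mulmxDr -!scalemxAr -!scalemxAl mulmx1 mul1mx.
by rewrite opprD addrACA subrr add0r -scalerBr.
Qed.

Lemma tr_commx_sym X Y : X^T = X -> Y^T = Y -> (commx X Y)^T = - commx X Y.
Proof. by move=> sX sY; rewrite /commx linearB /= !trmx_mul sX sY opprB. Qed.

Lemma tr_commx_skew_sym X Y : X^T = - X -> Y^T = Y -> (commx X Y)^T = commx X Y.
Proof.
move=> aX sY; rewrite /commx linearB /= !trmx_mul aX sY mulNmx mulmxN.
by rewrite opprK addrC.
Qed.

Lemma tr_commx_skew X Y : X^T = - X -> Y^T = - Y -> (commx X Y)^T = - commx X Y.
Proof.
move=> aX aY; rewrite /commx linearB /= !trmx_mul aX aY !mulNmx !mulmxN !opprK.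
by rewrite opprB.
Qed.

Lemma tr_acommx X Y : X^T = X -> Y^T = Y -> (acommx X Y)^T = acommx X Y.
Proof. by move=> sX sY; rewrite /acommx linearD /= !trmx_mul sX sY addrC. Qed.

End RotationGenerators.

(** * Skew and symmetric matrices: vector coordinates, brackets, centralizers *)

Section JordanAutomorphism.
Variable K : numFieldType.
Implicit Types (A X Y Z : 'M[K]_3) (i j k p q : 'I_3).

Lemma skew_diag X i : X^T = - X -> X i i = 0.
Proof.
move=> /matrixP/(_ i i); rewrite !mxE => /eqP.
by rewrite -addr_eq0 -mulr2n mulrn_eq0 => /eqP.
Qed.

(** For [p != q], the [(p, q)] entry of the bracket with [delta_mx q q] is [X p q]. *)
Lemma skew_commx_eq0 X :
  X^T = - X -> (forall i, commx X (delta_mx i i) = 0) -> X = 0.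
Proof.
move=> aX cX; apply/matrixP=> p q; rewrite mxE.
have [->|pq] := eqVneq p q; first exact: skew_diag.
have /matrixP/(_ p q) := cX q.
by rewrite [(0 : 'M[K]_3) p q]mxE mxE [X in _ + X]mxE mulmx_deltaE mul_delta_mxE eqxx
  (negPf pq) subr0.
Qed.

(** These three entries are the coordinates of the vector $u$ for which the matrix is $v\mapsto
    u\times v$. *)
Lemma skew_ext X Y : X^T = - X -> Y^T = - Y ->
  (forall i, X (i + 1 + 1) (i + 1) = Y (i + 1 + 1) (i + 1)) -> X = Y.
Proof.
move=> aX aY XY; have XN p q : X p q = - X q p.
  by move/matrixP/(_ q p): aX; rewrite !mxE.
have YN p q : Y p q = - Y q p by move/matrixP/(_ q p): aY; rewrite !mxE.
apply/matrixP => p q; elim/(@ord3_cyclicP p): q; first by rewrite !skew_diag.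
  by rewrite XN YN; have := XY (p + 1 + 1); rewrite !ord3E => ->.
by have := XY (p + 1); rewrite !ord3E.
Qed.

(** In vector coordinates the commutator is the cross product. *)
Lemma skew_commxE X Y i : X^T = - X -> Y^T = - Y ->
  commx X Y (i + 1 + 1) (i + 1) = X i (i + 1 + 1) * Y (i + 1) i
                                - Y i (i + 1 + 1) * X (i + 1) i.
Proof.
move=> aX aY; have XN p q : X p q = - X q p.
  by move/matrixP/(_ q p): aX; rewrite !mxE.
have YN p q : Y p q = - Y q p by move/matrixP/(_ q p): aY; rewrite !mxE.
rewrite !mxE !(sum_ord3 i) !(skew_diag _ aX) !(skew_diag _ aY).
rewrite (XN (i + 1) i) (XN (i + 1 + 1) i) (YN (i + 1) i) (YN (i + 1 + 1) i); ring.
Qed.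

Lemma symgen_neq0 k : symgen K k != 0.
Proof.
apply/eqP=> /matrixP/(_ (k + 1 + 1) (k + 1)); rewrite !mxE !ord3E add0r.
by move/eqP; rewrite oner_eq0.
Qed.

(** On skew matrices, $X\mapsto AXA^T$ acts in vector coordinates by the cofactor matrix of [A]. *)
Lemma mulmx_rotgen_cofactor A i k :
  (A *m rotgen K k *m A^T) (i + 1 + 1) (i + 1) = cofactor A i k.
Proof. by rewrite mulmx_rotgenE !mxE cofactor3; ring. Qed.

Lemma conj_rotgen A k i : special_orthogonal A ->
  (A *m rotgen K k *m A^T) (i + 1 + 1) (i + 1) = A i k.
Proof.
case/andP=> /eqP AAt /eqP dA; rewrite mulmx_rotgen_cofactor.
suff: \adj A = A^T by move/matrixP/(_ k i); rewrite !mxE.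
by rewrite -[LHS]mulmx1 -AAt mulmxA mul_adj_mx dA mul1mx.
Qed.

Lemma sym_ext (h : {linear 'M[K]_3 -> 'M[K]_3}) :
  (forall k, h (delta_mx k k) = delta_mx k k) ->
  (forall k, h (symgen K k) = symgen K k) -> forall X, X^T = X -> h X = X.
Proof.
move=> hE hF X sX.
have XC p q : X p q = X q p by move/matrixP/(_ q p): sX; rewrite !mxE.
have -> : X = \sum_k (X k k *: delta_mx k k + X (k + 1) (k + 1 + 1) *: symgen K k).
  apply/matrixP => p q; rewrite (sum_ord3 p) !mxE !ord3E.
  elim/(@ord3_cyclicP p): q; rewrite !ord3E /= ?(XC p (p + 1 + 1)); ring.
by rewrite linear_sum; apply: eq_bigr => k _; rewrite linearD !linearZ /= hE hF.
Qed.

(** Infinitesimal invariance under rotation about the [k]-th axis forces a scalar on the orthogonal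
    plane; four entries of the bracket suffice to see it. *)
Lemma commx_rotgen_eq0 X k : X^T = X -> commx (rotgen K k) X = 0 ->
  X = X (k + 1) (k + 1) *: 1%:M + (X k k - X (k + 1) (k + 1)) *: delta_mx k k.
Proof.
move=> sX /matrixP cX.
have XC p q : X p q = X q p by move/matrixP/(_ q p): sX; rewrite !mxE.
have cXE p q : commx (rotgen K k) X p q = X (k + 1) q *+ (p == k + 1 + 1)
    - X (k + 1 + 1) q *+ (p == k + 1)
    - (X p (k + 1 + 1) *+ (k + 1 == q) - X p (k + 1) *+ (k + 1 + 1 == q)).
  have subE (U V : 'M[K]_3) : (U - V) p q = U p q - V p q by rewrite !mxE.
  by rewrite /commx /rotgen mulmxBl mulmxBr !subE !mulmx_deltaE !mul_delta_mxE.
have := cX (k + 1 + 1) k; have := cX (k + 1) k; have := cX (k + 1 + 1) (k + 1).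
have := cX (k + 1) (k + 1).
rewrite !cXE !mxE !ord3E => c1 c2 c3 c4.
have x10 : X (k + 1) k = 0 by rewrite -c4; ring.
have x20 : X (k + 1 + 1) k = 0 by rewrite -[LHS]opprK -[RHS]oppr0 -c3; ring.
have x22 : X (k + 1 + 1) (k + 1 + 1) = X (k + 1) (k + 1).
  by apply/esym/eqP; rewrite -subr_eq0 -c2; apply/eqP; ring.
have x21 : X (k + 1 + 1) (k + 1) = 0.
  suff /eqP : X (k + 1 + 1) (k + 1) *+ 2 = 0 by rewrite mulrn_eq0 => /eqP.
  by rewrite -[RHS]oppr0 -c1 (XC (k + 1) (k + 1 + 1)); ring.
have := (x10, x20, x21, x22, XC k (k + 1), XC k (k + 1 + 1), XC (k + 1) (k + 1 + 1)).
move=> xE; apply/matrixP => p q; rewrite !mxE.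
by elim/(@ord3_cyclicP k): p; elim/(@ord3_cyclicP k): q; rewrite !ord3E /= ?xE; ring.
Qed.

(** * Rigidity of Jordan maps commuting with the rotation generators *)

Section EquivariantIsId.
Variable h : {linear 'M[K]_3 -> 'M[K]_3}.
Hypothesis hT : forall X, X^T = X -> (h X)^T = h X.
Hypothesis hJ : forall X Y, X^T = X -> Y^T = Y ->
  h (acommx X Y) = acommx (h X) (h Y).
Hypothesis hI : forall X, X^T = X -> h X = 0 -> X = 0.
Hypothesis hL : forall k X, X^T = X ->
  h (commx (rotgen K k) X) = commx (rotgen K k) (h X).

Lemma equivariant_id X : X^T = X -> h X = X.
Proof.
have sE k : (delta_mx k k : 'M[K]_3)^T = delta_mx k k by rewrite trmx_delta.
(* [delta_mx k k] commutes with [rotgen k], hence so does its image. *)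
have [b [c hE]] : exists b c : 'I_3 -> K,
    forall k, h (delta_mx k k) = b k *: 1%:M + c k *: delta_mx k k.
  pose T k := h (delta_mx k k).
  exists (fun k => T k (k + 1) (k + 1)), (fun k => T k k k - T k (k + 1) (k + 1)).
  move=> k; apply: commx_rotgen_eq0; first exact: hT.
  rewrite -hL // /commx /rotgen mulmxBl mulmxBr !mul_delta_mx_cond !ord3E.
  by rewrite !subr0 linear0.
have hF k : h (symgen K k) = c (k + 1 + 1) *: symgen K k.
  apply: oppr_inj; rewrite -linearN -scalerN -commx_rotgen_delta hL // hE.
  by rewrite commx_add_scalar.
have c0 k : c k != 0.
  apply/eqP => ck; have := hF (k + 1); rewrite !ord3E ck scale0r.
  by move/hI => /(_ (tr_symgen _ _))/eqP; rewrite (negPf (symgen_neq0 _)).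
(* Distinct diagonal units have zero anticommutator; comparing the diagonal entries of its image at
   [k] and [k + 1 + 1] isolates [c k * b (k + 1)]. *)
have b0 k : b (k + 1) = 0.
  have /matrixP hEE : acommx (h (delta_mx k k)) (h (delta_mx (k + 1) (k + 1))) = 0.
    by rewrite -hJ // /acommx !mul_delta_mx_cond !ord3E addr0 linear0.
  have := hEE k k; have := hEE (k + 1 + 1) (k + 1 + 1).
  rewrite !hE /acommx !mxE !(sum_ord3 k) !mxE !ord3E /= => e2 e0.
  apply/eqP; suff /eqP : c k * b (k + 1) *+ 2 = 0.
    by rewrite mulrn_eq0 mulf_eq0 (negPf (c0 k)).
  have e2' : b k * b (k + 1) *+ 2 = 0 by rewrite -[RHS]e2; ring.
  have e0' : (b k + c k) * b (k + 1) *+ 2 = 0 by rewrite -[RHS]e0; ring.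
  have -> : c k * b (k + 1) *+ 2 = (b k + c k) * b (k + 1) *+ 2
                                 - b k * b (k + 1) *+ 2 by ring.
  by rewrite e0' e2' subrr.
have hE' k : h (delta_mx k k) = c k *: delta_mx k k.
  by rewrite hE; have := b0 (k + 1 + 1); rewrite !ord3E => ->; rewrite scale0r add0r.
(* Idempotence of [delta_mx k k] gives $c_k^2=c_k$, and $c_k\neq 0$. *)
have c1 k : c k = 1.
  have /matrixP/(_ k k) := hJ (sE k) (sE k).
  rewrite /acommx mul_delta_mx -mulr2n linearMn /= hE' -scalemxAl -scalemxAr.
  rewrite mul_delta_mx scalerA -mulr2n !mxE !eqxx !mulr1 => /eqP.
  rewrite -subr_eq0 (_ : _ - _ = c k * (1 - c k) *+ 2); last by ring.
  by rewrite mulrn_eq0 mulf_eq0 (negPf (c0 k)) subr_eq0 => /eqP ->.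
by apply: sym_ext => k; rewrite ?hE' ?hF c1 scale1r.
Qed.
End EquivariantIsId.

(** * The rotation attached to a Jordan automorphism *)

Section Rotation.
Variable g : {linear 'M[K]_3 -> 'M[K]_3}.
Hypothesis gT : forall X, X^T = X -> (g X)^T = g X.
Hypothesis gJ : forall X Y, X^T = X -> Y^T = Y ->
  g (acommx X Y) = acommx (g X) (g Y).
Hypothesis gI : forall X, X^T = X -> g X = 0 -> X = 0.
Hypothesis gS : forall Y, Y^T = Y -> exists2 X, X^T = X & g X = Y.

(** The transport of [rotgen k] along [g], via the presentation in [commx_delta_symgen]. *)
Let M k := commx (g (delta_mx (k + 1 + 1) (k + 1 + 1))) (g (symgen K k)).

(** Column [k] holds the vector coordinates of the skew matrix [M k]. *)
Definition rotation_of : 'M[K]_3 := \matrix_(i, k) M k (i + 1 + 1) (i + 1).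

Let M_tr k : (M k)^T = - M k.
Proof. by apply: tr_commx_sym; apply: gT; rewrite ?trmx_delta ?tr_symgen. Qed.

Let M_commx k Z : Z^T = Z -> commx (M k) (g Z) = g (commx (rotgen K k) Z).
Proof.
move=> sZ; rewrite -commx_delta_symgen /M.
set E := delta_mx _ _; have sE : E^T = E by rewrite trmx_delta.
have sF := tr_symgen K k.
by rewrite !commx_commxE -!gJ ?tr_acommx // -linearB.
Qed.

(* Both sides act on symmetric matrices as g (commx (rotgen k) _) g^-1, and this
   action of skew-symmetric matrices is faithful. *)
Let M_bracket k : commx (M (k + 1)) (M (k + 1 + 1)) = M k.
Proof.
apply/eqP; rewrite -subr_eq0; apply/eqP/skew_commx_eq0.
  by rewrite linearB /= M_tr tr_commx_skew ?M_tr // -opprD.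
move=> i; have [Z sZ <-] := gS (trmx_delta _ i i : (delta_mx i i)^T = delta_mx i i).
have sL j : (commx (rotgen K j) Z)^T = commx (rotgen K j) Z.
  by rewrite tr_commx_skew_sym ?tr_rotgen.
rewrite commxBl commx_jacobi !M_commx // -!linearB -commx_jacobi commx_rotgen.
by rewrite subrr linear0.
Qed.

(** In coordinates, [M_bracket] says that each column is the cross product of the next two in cyclic
    order. *)
Let rotation_cofactor i k : cofactor rotation_of i k = rotation_of i k.
Proof.
have AE p q : rotation_of p q = M q (p + 1 + 1) (p + 1) by rewrite mxE.
by rewrite cofactor3 !AE -[in RHS]M_bracket skew_commxE ?M_tr // !ord3E.
Qed.

Let M_conj k : rotation_of *m rotgen K k *m rotation_of^T = M k.
Proof.
apply: skew_ext => // [|i].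
  by rewrite !trmx_mul trmxK tr_rotgen mulNmx mulmxN mulmxA.
by rewrite mulmx_rotgen_cofactor rotation_cofactor mxE.
Qed.

Lemma rotation_of_special : special_orthogonal rotation_of.
Proof.
set A := rotation_of; have adjA : \adj A = A^T.
  by apply/matrixP => i j; rewrite mxE [RHS]mxE rotation_cofactor.
have AAt := mul_mx_adj A; have AtA := mul_adj_mx A; rewrite adjA in AAt AtA.
(* Otherwise $A^TA=0$, so by [M_conj] all products [M k *m M l] vanish; then [M 0 = 0] and [g] kills
   [symgen 0]. *)
have dA : \det A != 0.
  apply/eqP => dA; rewrite dA raddf0 in AtA.
  have MM k l : M k *m M l = 0.
    rewrite -!M_conj -/A !mulmxA -[_ *m A^T *m A]mulmxA AtA.
    by rewrite mulmx0 !mul0mx.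
  have M0 : M 0 = 0 by rewrite -M_bracket /commx !MM subrr.
  have : g (symgen K 0) = 0.
    rewrite -[symgen K 0]opprK -commx_rotgen_delta linearN -M_commx ?trmx_delta //.
    by rewrite M0 /commx mul0mx mulmx0 subrr oppr0.
  by move/(gI (tr_symgen K 0))/eqP; rewrite (negPf (symgen_neq0 0)).
(* Taking determinants in $AA^T=(\det A)E$ gives $d^2=d^3$ for $d=\det A$. *)
have d1 : \det A = 1.
  have := congr1 determinant AAt; rewrite det_mulmx det_tr det_scalar.
  rewrite exprS expr2 => /(mulfI dA) dd.
  by apply: (mulfI dA); rewrite mulr1 -dd.
by rewrite /special_orthogonal AAt d1 !eqxx.
Qed.

Lemma rotation_ofP X : X^T = X -> g X = rotation_of *m X *m rotation_of^T.
Proof.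
have /andP[/eqP AAt _] := rotation_of_special.
set A := rotation_of in AAt *; have AtA := mulmx1C AAt.
pose h : {linear _ -> _} := mulmxr A \o mulmx A^T \o g.
have hE Z : h Z = A^T *m g Z *m A by [].
have gE Z : g Z = A *m h Z *m A^T.
  by rewrite hE !mulmxA AAt mul1mx -mulmxA AAt mulmx1.
move=> sX; rewrite gE; congr (_ *m _ *m _); apply: equivariant_id => {X sX} //.
- by move=> X sX; rewrite hE !trmx_mul trmxK gT // mulmxA.
- move=> X Y sX sY; rewrite !hE gJ // /acommx mulmxDr mulmxDl !mulmxA.
  by rewrite -!(mulmxA _ A A^T) AAt !mulmx1.
- by move=> X sX hX0; apply: gI => //; rewrite gE hX0 mulmx0 mul0mx.
(* By [M_conj], conjugating back by $A^T$ turns the bracket with [M k] into the bracket with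
   [rotgen k]. *)
move=> k X sX; rewrite !hE -M_commx // -M_conj -/A /commx mulmxBr mulmxBl !mulmxA.
by rewrite AtA mul1mx -!(mulmxA _ A^T A) AtA mulmx1.
Qed.
End Rotation.

End JordanAutomorphism.

(** * Coordinates and holomorphy of quadratic maps *)

Lemma coords_linear (K : numFieldType) (V : vectType K) : linear (@coords K V).
Proof. exact: passmx.rVof_linear. Qed.
HB.instance Definition _ (K : numFieldType) (V : vectType K) :=
  GRing.isLinear.Build K V 'rV[K]_(\dim {:V}) _ (@coords K V)
    (@coords_linear K V).

(** Expanding the argument in a basis gives a quadratic polynomial in its coordinates,
    differentiable everywhere. *)
Lemma holomorphic_bilinear (K : numFieldType) (V W : vectType K)
  (B : {bilinear V -> V -> W}) x : holomorphic_at (fun u => B u u) x.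
Proof.
near=> y.
pose e := vbasis {:V}.
have -> : @coords K W \o (fun u => B u u) \o @of_coords K V = \sum_i \sum_j
    (fun z : 'rV[K]_(\dim {:V}) => (z 0 i * z 0 j) *: coords (B e`_i e`_j)).
  apply/funext => z; rewrite fct_sumE /= /of_coords /passmx.vecof.
  rewrite linear_sumlz linear_sum; apply: eq_bigr => i _; rewrite fct_sumE.
  rewrite linear_sumr linear_sum; apply: eq_bigr => j _.
  by rewrite linearZl_LR linearZr_LR !linearZ /= scalerA.
apply: differentiable_sum => i; apply: differentiable_sum => j.
apply: differentiableZl.
exact: (differentiableM (differentiable_coord _ _ _) (differentiable_coord _ _ _)).
Unshelve. all: by end_near.
Qed.

(** * Passage between Jordan automorphisms and rotations by ambient bilinear maps *)

Section Isomorphism.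
Variable K : numFieldType.
Implicit Types (a : 'End(symJ K)) (A X Y : 'M[K]_3).

Lemma vsval_tr (x : symJ K) : (vsval x)^T = vsval x.
Proof. exact/symmxP/(valP x). Qed.

Lemma vsproj_symK X : X^T = X -> vsval (vsproj (symmx K) X) = X.
Proof. by move=> sX; rewrite vsprojK //; apply/symmxP. Qed.

(** Projecting first extends [a] to all matrices, linearly in [a], so that the results on linear
    maps of ['M[K]_3] apply. *)
Definition symext a : 'M[K]_3 -> 'M[K]_3 := vsval \o a \o vsproj (symmx K).

Lemma symext_linear a : linear (symext a).
Proof. by move=> b X Y; rewrite /symext /= !linearP. Qed.
HB.instance Definition _ a :=
  GRing.isLinear.Build K 'M[K]_3 'M[K]_3 _ (symext a) (symext_linear a).

Lemma symextE a x : symext a (vsval x) = vsval (a x).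
Proof. by rewrite /symext /= vsvalK. Qed.

Lemma symext_tr a X : (symext a X)^T = symext a X.
Proof. exact: vsval_tr. Qed.

Lemma symextZ a b X : symext a (b *: X) = b *: symext a X.
Proof. exact: linearZ. Qed.

Lemma symextP b a a' X : symext (b *: a + a') X = b *: symext a X + symext a' X.
Proof. by rewrite /symext /= add_lfunE scale_lfunE linearP. Qed.

(* Polarization of [rotation_of]: [rotation_form a a] is [rotation_of (symext a)]. *)
Definition rotation_form a a' : 'M[K]_3 := \matrix_(i, k)
  commx (symext a (delta_mx (k + 1 + 1) (k + 1 + 1))) (symext a' (symgen K k))
    (i + 1 + 1) (i + 1).

Lemma rotation_form_bilinear : bilinear_for *:%R *:%R rotation_form.
Proof.
have matP b X Y i j : (b *: X + Y) i j = b * X i j + Y i j by rewrite !mxE.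
by split=> u b v w; apply/matrixP => i k;
  rewrite matP ![rotation_form _ _ _ _]mxE symextP ?commxPl ?commxPr matP.
Qed.
HB.instance Definition _ :=
  bilinear_isBilinear.Build K 'End(symJ K) 'End(symJ K) 'M[K]_3 _ _ rotation_form rotation_form_bilinear.

(** Polarizes $X\mapsto AXA^T$; the projection is there because $AXB^T$ need not be symmetric when
    $A\neq B$. *)
Definition conj_form A B : 'End(symJ K) :=
  linfun (vsproj (symmx K) \o mulmxr B^T \o mulmx A \o vsval).

Lemma conj_form_bilinear : bilinear_for *:%R *:%R conj_form.
Proof.
split=> U b V W; apply/lfunP => x; rewrite add_lfunE scale_lfunE !lfunE /=.
  by rewrite !mulmxDl -!scalemxAl linearP.
by rewrite linearP /= mulmxDr -scalemxAr linearP.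
Qed.
HB.instance Definition _ := bilinear_isBilinear.Build K 'M[K]_3 'M[K]_3
  'End(symJ K) _ _ conj_form conj_form_bilinear.

Lemma conj_formE A (x : symJ K) : vsval (conj_form A A x) = A *m vsval x *m A^T.
Proof.
by rewrite lfunE /= vsproj_symK // !trmx_mul trmxK vsval_tr mulmxA.
Qed.

Lemma vsval_jordan (x y : symJ K) :
  vsval (jordan x y) = 2^-1 *: acommx (vsval x) (vsval y).
Proof. by []. Qed.

Lemma conj_form_automorphism (A : SO3 K) :
  `[< jordan_automorphism (conj_form A A) >].
Proof.
have /andP[/eqP AAt _] := SO3valP A; have AtA := mulmx1C AAt.
apply/asboolP; split=> [|x y].
  exists (conj_form A^T A^T) => x; apply: val_inj; rewrite /= !conj_formE trmxK.
    by rewrite !mulmxA AtA mul1mx -mulmxA AtA mulmx1.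
  by rewrite !mulmxA AAt mul1mx -mulmxA AAt mulmx1.
apply: val_inj; rewrite /= conj_formE !vsval_jordan !conj_formE.
rewrite -scalemxAr -scalemxAl /acommx mulmxDr mulmxDl !mulmxA.
by rewrite -!(mulmxA _ A^T A) AtA !mulmx1.
Qed.

Section Automorphism.
Variable a : 'End(symJ K).
Hypothesis autoa : jordan_automorphism a.

Lemma symext_acommx X Y : X^T = X -> Y^T = Y ->
  symext a (acommx X Y) = acommx (symext a X) (symext a Y).
Proof.
move=> sX sY; have [_ aJ] := autoa.
have -> : acommx X Y = 2 *: vsval (jordan (vsproj (symmx K) X) (vsproj (symmx K) Y)).
  by rewrite vsval_jordan !vsproj_symK // scalerA divff ?pnatr_eq0 // scale1r.
by rewrite symextZ symextE aJ vsval_jordan scalerA divff ?pnatr_eq0 // scale1r.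
Qed.

Lemma symext_eq0 X : X^T = X -> symext a X = 0 -> X = 0.
Proof.
move=> sX aX0; have [/bij_inj aI _] := autoa.
rewrite -(vsproj_symK sX) (_ : vsproj _ X = 0) ?linear0 //.
by apply/aI/val_inj; rewrite /= -symextE vsproj_symK // aX0 !linear0.
Qed.

Lemma symext_surj Y : Y^T = Y -> exists2 X, X^T = X & symext a X = Y.
Proof.
move=> sY; have [[b ab ba] _] := autoa.
exists (vsval (b (vsproj (symmx K) Y))); first exact: vsval_tr.
by rewrite symextE ba vsproj_symK.
Qed.

Lemma rotation_form_special : special_orthogonal (rotation_form a a).
Proof.
exact: (rotation_of_special (fun X _ => symext_tr a X)
  symext_acommx symext_eq0 symext_surj).
Qed.

Lemma conj_rotation_form : conj_form (rotation_form a a) (rotation_form a a) = a.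
Proof.
apply/lfunP => x; apply: val_inj; rewrite /= conj_formE -symextE.
by rewrite (rotation_ofP (fun X _ => symext_tr a X)
  symext_acommx symext_eq0 symext_surj) ?vsval_tr.
Qed.

End Automorphism.

(** Conjugation by [A] passes through commutators, so the transported generators are
    $A\,$[rotgen k]$\,A^T$, whose coordinates [conj_rotgen] reads off as the columns of [A]. *)
Lemma rotation_conj_form A :
  special_orthogonal A -> rotation_form (conj_form A A) (conj_form A A) = A.
Proof.
move=> sA; have /andP[/eqP AAt _] := sA; have AtA := mulmx1C AAt.
have symextE' X : X^T = X -> symext (conj_form A A) X = A *m X *m A^T.
  by move=> sX; rewrite -(vsproj_symK sX) symextE conj_formE.
apply/matrixP => i k; rewrite mxE -(conj_rotgen k i sA) -commx_delta_symgen.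
rewrite !symextE' ?trmx_delta ?tr_symgen // /commx mulmxBr mulmxBl !mulmxA.
by rewrite -!(mulmxA _ A^T A) AtA !mulmx1.
Qed.

Definition F4R_of_SO3 (A : SO3 K) : F4R K := MkF4R (conj_form_automorphism A).
Definition SO3_of_F4R (a : F4R K) : SO3 K :=
  MkSO3 (rotation_form_special (asboolW (F4RvalP a))).

Lemma F4R_of_SO3K : cancel F4R_of_SO3 SO3_of_F4R.
Proof. by move=> A; apply: val_inj; exact: rotation_conj_form (SO3valP A). Qed.

Lemma SO3_of_F4RK : cancel SO3_of_F4R F4R_of_SO3.
Proof.
by move=> a; apply: val_inj; exact: conj_rotation_form (asboolW (F4RvalP a)).
Qed.

Lemma F4R_of_SO3M : {morph F4R_of_SO3 : A B / (A * B)%g}.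
Proof.
move=> A B; apply/val_inj/lfunP => x; apply/val_inj.
by rewrite /= comp_lfunE /= !conj_formE /= trmx_mul !mulmxA.
Qed.

End Isomorphism.

Theorem theorem3p2 (R : realType) :
  lie_isomorphic (@F4Rval R[i]) (@SO3val R[i]).
Proof.
exists (@SO3_of_F4R R[i]), (@F4R_of_SO3 R[i]).
split; [|exact: SO3_of_F4RK|exact: F4R_of_SO3K| |].
(* Multiplicativity is immediate for conjugation; the inverse map inherits it by injectivity. *)
- move=> a b; apply: (can_inj (@F4R_of_SO3K _)).
  by rewrite F4R_of_SO3M !SO3_of_F4RK.
(* This ambient quadratic map restricts to [SO3_of_F4R] by definition, so any neighbourhood
   works. *)
- move=> a; exists (fun b => rotation_form b b); first exact: holomorphic_bilinear.
  by near=> y => b yE.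
- move=> A; exists (fun B => conj_form B B); first exact: holomorphic_bilinear.
  by near=> y => B yE.
Unshelve. all: by end_near.
Qed.
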